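(* Let $P$ be a prime and $J$ a positive integer. Let $\mathrm{B}$ be a symplectic form on a vector space $\mathcal{V}$ of dimension $2J$ over $\mathbb{F}_P$, let $\Phi=(\varphi_v)_{v\in\mathcal{V}}$ be a corresponding symplectic ETF, and let $\Psi=(\psi_v)_{v\in\mathcal{V}}$ be its dual. Then the binder $\operatorname{bin}(\Psi)$ consists of all affine Lagrangian subspaces of $\mathcal{V}$, that is, all subsets of $\mathcal{V}$ of the form $v+\mathcal{L}$ where $v\in\mathcal{V}$ and $\mathcal{L}\subseteq\mathcal{V}$ satisfies $\mathcal{L}^\perp=\mathcal{L}$. This binder forms a BIBD with parameters \[ V=P^{2J},\quad K=P^J,\quad \Lambda=\prod_{j=1}^{J-1}(P^j+1),\quad R=\prod_{j=1}^{J}(P^j+1),\quad B=P^J\prod_{j=1}^{J}(P^j+1). \] Moreover, a subset of this binder forms an affine plane of order $Q=P^J$, namely a BIBD with $(V,K,\Lambda,R,B)=(Q^2,Q,1,Q+1,Q(Q+1))$.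
   Context: A symplectic form on a vector space $\mathcal{V}$ over a field is a bilinear form $\mathrm{B}$ that is alternating ($\mathrm{B}(v,v)=0$ for all $v$) and nondegenerate (for each $v_1\neq0$ there is $v_2$ with $\mathrm{B}(v_1,v_2)\neq0$). For $\mathcal{S}\subseteq\mathcal{V}$, $\mathcal{S}^\perp=\{v_2\in\mathcal{V}:\mathrm{B}(v_1,v_2)=0\ \forall v_1\in\mathcal{S}\}$. An empty product equals $1$. ETFs: let $\mathbb{F}\in\{\mathbb{R},\mathbb{C}\}$. A finite sequence $(\varphi_n)_{n\in\mathcal{N}}$ in a Hilbert space over $\mathbb{F}$ ($\mathcal{N}$ finite, nonempty) is an equiangular tight frame (ETF) if (i) $\|\varphi_n\|^2=S$ for all $n$ for some $S>0$, (ii) $|\langle\varphi_{n_1},\varphi_{n_2}\rangle|^2=C$ for all $n_1\neq n_2$ for some $C>0$, and (iii) for some $A>0$, $\sum_n\langle\varphi_n,y\rangle\varphi_n=Ay$ for all $y$ in its span. For nonempty $\mathcal{K}\subseteq\mathcal{N}$, $(\varphi_n)_{n\in\mathcal{K}}$ is a regular simplex if it is an ETF whose span has dimension $\#(\mathcal{K})-1$. The binder $\operatorname{bin}(\Phi)$ of an ETF $\Phi=(\varphi_n)_{n\in\mathcal{N}}$ is the set of all $\mathcal{K}\subseteq\mathcal{N}$ such that $(\varphi_n)_{n\in\mathcal{K}}$ is a regular simplex. Symplectic ETF: let $\mathbb{F}=\mathbb{R}$ if $P=2$ and $\mathbb{F}=\mathbb{C}$ if $P>2$; $\mathrm{i}$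 is the imaginary unit. A symplectic ETF corresponding to $\mathrm{B}$ is a finite sequence $\Phi=(\varphi_v)_{v\in\mathcal{V}}$ in a Hilbert space over $\mathbb{F}$ with $\langle\varphi_v,\varphi_v\rangle=P^J+1$ and $\langle\varphi_{v_1},\varphi_{v_2}\rangle=\exp(\frac{2\pi\mathrm{i}}{P}\mathrm{B}(v_1,v_2))$ for $v_1\neq v_2$. Its dual is a finite sequence $\Psi=(\psi_v)_{v\in\mathcal{V}}$ with $\langle\psi_v,\psi_v\rangle=P^J-1$ and $\langle\psi_{v_1},\psi_{v_2}\rangle=-\exp(\frac{2\pi\mathrm{i}}{P}\mathrm{B}(v_1,v_2))$ for $v_1\neq v_2$. Such $\Phi,\Psi$ exist, and are $P^{2J}$-vector ETFs whose spans have dimension $\frac12P^J(P^J+1)$ and $\frac12P^J(P^J-1)$, respectively. BIBDs: a BIBD consists of a finite vertex set of size $V$ and a finite nonempty sequence of $B$ subsets (blocks), all of the same size $K\geq2$, such that any two distinct vertices are contained together in exactly $\Lambda$ blocks; then every vertex lies in the same number $R$ of blocks. A set of subsets of a vertex set (here $\mathcal{V}$) forms a BIBD if an enumeration of it without repetition is the block sequence of a BIBD. *)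

(* Defs.v *)
From HB Require Import structures.
From mathcomp Require Import all_boot all_order all_algebra finfield.
From mathcomp Require Import sesquilinear.
From mathcomp Require Import all_classical all_reals all_analysis.
From mathcomp Require Import complex.

Set Implicit Arguments.
Unset Strict Implicit.
Unset Printing Implicit Defensive.

Import Order.TTheory GRing.Theory Num.Theory.
Import numFieldNormedType.Exports.

Local Open Scope ring_scope.

(* The scalar fields of the Hilbert spaces: a numeric field with its conjugation
   and its embedding in R[i]. Only the two instances below are ever used. *)
Record scalars (R : realType) := Scalars {
  scalar_field :> numFieldType;
  sconj : {rmorphism scalar_field -> scalar_field};
  sembed : {rmorphism scalar_field -> R[i]}
}.

Definition real_scalars (R : realType) : scalars R :=
  @Scalars R R idfun (real_complex R).

Definition complex_scalars (R : realType) : scalars R :=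
  @Scalars R R[i] (@Num.conj R[i]) idfun.

Definition symplectic_scalars (R : realType) (P : nat) : scalars R :=
  if P == 2 then real_scalars R else complex_scalars R.

Record hilbert (R : realType) (F : scalars R) := Hilbert {
  hspace :> completeNormedModType F;
  hdot : {dot hspace for sconj F};
  hdotE : forall x : hspace, hdot x x = `|x| ^+ 2
}.

(* hdot is linear in its first argument; the inner product used here is linear
   in its second argument, as the frame identity below requires. *)
Definition inner (R : realType) (F : scalars R) (H : hilbert F) (x y : H) : F :=
  hdot H y x.

Section Frames.
Variables (R : realType) (F : scalars R) (H : hilbert F).

Definition family_span (N : finType) (K : {set N}) (phi : N -> H) : set H :=
  [set y | exists c : N -> F, y = \sum_(n in K) c n *: phi n]%classic.

Definition lin_indep (d : nat) (b : 'I_d -> H) : Prop :=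
  forall c : 'I_d -> F, \sum_(i < d) c i *: b i = 0 -> forall i, c i = 0.

Definition has_dim (S : set H) (d : nat) : Prop :=
  exists b : 'I_d -> H, lin_indep b /\ S = family_span [set: 'I_d]%SET b.

Variable N : finType.
Implicit Types (phi : N -> H) (K : {set N}).

(* The subsequence of phi indexed by K is an equiangular tight frame. *)
Definition is_etf phi K : Prop :=
  [/\ K != finset.set0,
      exists2 S : F, 0 < S & forall n, n \in K -> `|phi n| ^+ 2 = S,
      exists2 C : F, 0 < C &
        forall n1 n2, n1 \in K -> n2 \in K -> n1 != n2 ->
          `|inner (phi n1) (phi n2)| ^+ 2 = C
    & exists2 A : F, 0 < A &
        forall y, family_span K phi y ->
          \sum_(n in K) inner (phi n) y *: phi n = A *: y].

Definition regular_simplex phi K : Prop :=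
  is_etf phi K /\ has_dim (family_span K phi) (#|K| - 1)%N.

Definition binder phi : {set {set N}} :=
  [set K : {set N} | `[< regular_simplex phi K >]]%SET.

End Frames.

Definition cexp (R : realType) (z : R[i]) : R[i] :=
  Complex (expR (complex.Re z) * cos (complex.Im z))
          (expR (complex.Re z) * sin (complex.Im z)).

(* b : 'F_P is read through its representative in {0, ..., P-1}. *)
Definition character (R : realType) (P : nat) (b : 'F_P) : R[i] :=
  cexp (Complex 0 (2 * pi / P%:R * (val b)%:R)).

Section Symplectic.
Variables (P : nat) (V : vectType 'F_P) (B : {biscalar V}).

Definition symplectic_form : Prop :=
  (forall v : V, B v v = 0) /\
  (forall v1 : V, v1 != 0 -> exists v2 : V, B v1 v2 != 0).

Definition perp (S : {set finvect_type V}) : {set finvect_type V} :=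
  [set v2 : finvect_type V | [forall (v1 | v1 \in S), B v1 v2 == 0]]%SET.

Definition affine_lagrangian (K : {set finvect_type V}) : Prop :=
  exists (v : finvect_type V) (L : {set finvect_type V}),
    perp L = L /\ K = [set v + x | x in L]%SET.

Variables (R : realType) (H : hilbert (symplectic_scalars R P)).

(* The equations live in R[i] because exp(2 pi i B(v1, v2) / P) does, even when
   the scalars are real. *)
Definition symplectic_etf (J : nat) (Phi : finvect_type V -> H) : Prop :=
  (forall v, inner (Phi v) (Phi v) = (P ^ J)%:R + 1) /\
  (forall v1 v2, v1 != v2 ->
     sembed _ (inner (Phi v1) (Phi v2)) = character R (B v1 v2)).

Definition dual_symplectic_etf (J : nat) (Psi : finvect_type V -> H) : Prop :=
  (forall v, inner (Psi v) (Psi v) = (P ^ J)%:R - 1) /\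
  (forall v1 v2, v1 != v2 ->
     sembed _ (inner (Psi v1) (Psi v2)) = - character R (B v1 v2)).

End Symplectic.

Section BIBD.
Variable T : finType.

Definition is_bibd (blocks : seq {set T}) (v k lam r b : nat) : Prop :=
  [/\ #|T| = v, (size blocks = b /\ (0 < b)%N),
      ((2 <= k)%N /\ forall K, K \in blocks -> #|K| = k),
      forall x y, x != y ->
        count (fun K : {set T} => (x \in K) && (y \in K)) blocks = lam
    & forall x, count (fun K : {set T} => x \in K) blocks = r].

Definition forms_bibd (X : {set {set T}}) (v k lam r b : nat) : Prop :=
  exists blocks : seq {set T},
    [/\ uniq blocks, blocks =i X & is_bibd blocks v k lam r b].

Definition forms_affine_plane (X : {set {set T}}) (q : nat) : Prop :=
  forms_bibd X (q ^ 2) q 1 (q + 1) (q * (q + 1)).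

End BIBD.

(* Main.v *)
(* Let G be the Gram matrix of psi on a K of n elements. Tightness reads
   G^2 = A G, so if K spans dimension n - 1 then A - G has rank one. Its diagonal
   is A - (P^J - 1) and its other entries are the unimodular chi(B(i, j)); the
   2 x 2 minors force the diagonal to be 1, hence n = P^J and
   B(i, j) = B(i, k) + B(k, j) on K. That is, K - k is an isotropic set of P^J
   vectors, i.e. a Lagrangian. The same computation run backwards shows that
   translates of Lagrangians are regular simplices.
   Lagrangians through x <> 0 correspond to Lagrangians of {x, y}^perp where
   B(x, y) = 1, and double counting pairs (x, L) with x in L yields the product
   formula by induction on J. *)

Require Import Defs.
From HB Require Import structures.
From mathcomp Require Import all_boot all_order all_algebra finfield.
From mathcomp Require Import sesquilinear.
From mathcomp Require Import all_classical all_reals all_analysis.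
From mathcomp Require Import complex.
From mathcomp Require Import fieldext ring.

Set Implicit Arguments.
Unset Strict Implicit.
Unset Printing Implicit Defensive.

Import Order.TTheory GRing.Theory Num.Theory.
Import numFieldNormedType.Exports.

Local Open Scope ring_scope.

(** * Counting Lagrangians *)

Lemma double_counting (T : finType) (X : {set {set T}}) (A : {set T}) :
  (\sum_(K in X) #|K :&: A| = \sum_(x in A) #|[set K in X | x \in K]%SET|)%N.
Proof.
under eq_bigr => K _ do rewrite -sum1_card.
rewrite (exchange_big_dep (mem A)) /=; last by move=> K x _; rewrite inE => /andP[].
apply: eq_bigr => x xA; rewrite -sum1_card; apply: eq_bigl => K.
by rewrite !inE xA andbT.
Qed.

Section Isotropic.
Variables (F : finFieldType) (T : finLmodType F) (b : {biscalar T}).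
Hypothesis b_alt : forall v, b v v = 0.
Implicit Types (x y u v w : T) (U L M S : {set T}).

Lemma alt_skew u v : b u v = - b v u.
Proof.
apply/eqP; rewrite -addr_eq0; have := b_alt (u + v).
by rewrite linearDl !linearDr /= !b_alt addr0 add0r => ->.
Qed.

Definition orth S : {set T} := [set v | [forall (u | u \in S), b u v == 0]]%SET.

Lemma orthP S v : reflect {in S, forall u, b u v = 0} (v \in orth S).
Proof.
rewrite inE; apply: (iffP forall_inP) => h u uS; first exact/eqP/h.
by rewrite h.
Qed.

Lemma orth_submod S : submod_closed (orth S).
Proof.
split=> [|a u v /orthP uS /orthP vS]; apply/orthP => w wS; first exact: linear0r.
by rewrite linearPr /= uS // vS // mulr0 addr0.
Qed.

(** Relative to a subset [U] of a fixed ambient space, as is [nondegenerate], so that an induction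
    on dimension can pass to a smaller subspace without changing the type. *)
Definition lagrangians U : {set {set T}} := [set L | U :&: orth L == L]%SET.

Lemma lagrangianP U L :
  reflect (forall v, (v \in L) = (v \in U) && (v \in orth L)) (L \in lagrangians U).
Proof.
rewrite inE; apply: (iffP eqP) => [h v|h]; first by rewrite -{1}h inE.
by apply/setP => v; rewrite h inE.
Qed.

Definition nondegenerate U : Prop :=
  {in U, forall u, u != 0 -> exists2 w, w \in U & b u w != 0}.

(** Linearity is not part of the definition: it comes from [L] being the intersection of the
    submodules [U] and [orth L]. *)
Lemma lagrangian_submod U L :
  submod_closed U -> L \in lagrangians U -> submod_closed L.
Proof.
move=> [U0 Uc] /lagrangianP LE; have [oS0 oSc] := orth_submod L.
split=> [|a u v]; rewrite !LE ?U0 ?oS0 // => /andP[uU uo] /andP[vU vo].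
by rewrite Uc ?oSc.
Qed.

Lemma lagrangian_isotropic U L : L \in lagrangians U ->
  {in L &, forall u v, b u v = 0}.
Proof. by move=> /lagrangianP LE u v uL; rewrite LE => /andP[_ /orthP]; apply. Qed.

Lemma lagrangian_sub U L : L \in lagrangians U -> L \subset U.
Proof. by move=> /lagrangianP LE; apply/fintype.subsetP => v; rewrite LE => /andP[]. Qed.

(** * Reduction of Lagrangians along a hyperbolic pair *)

Section HyperbolicPair.
Variables (U : {set T}) (x y : T).
Hypotheses (Usub : submod_closed U) (xU : x \in U) (yU : y \in U) (bxy : b x y = 1).

Definition hyp_orth : {set T} := [set u in U | (b u x == 0) && (b u y == 0)]%SET.
(** Projection of [U] onto [hyp_orth] along the plane of [x] and [y]. As [b x y = 1], the coordinate
    of [u] along [x] is [b u y] and the one along [y] is [- b u x]. *)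
Definition hyp_proj u : T := u - b u y *: x + b u x *: y.
Local Notation W := hyp_orth.
Local Notation pr := hyp_proj.

Let byx : b y x = -1. Proof. by rewrite alt_skew bxy. Qed.

Lemma hyp_orthP u : reflect [/\ u \in U, b u x = 0 & b u y = 0] (u \in W).
Proof.
by rewrite inE; apply: (iffP and3P) => -[-> /eqP-> /eqP->]; split.
Qed.

Lemma hyp_orth_submod : submod_closed W.
Proof.
have [U0 Uc] := Usub; split=> [|a u v /hyp_orthP[uU ux uy] /hyp_orthP[vU vx vy]].
  by apply/hyp_orthP; rewrite !linear0l.
by apply/hyp_orthP; rewrite !linearPl /= ux uy vx vy mulr0 addr0 Uc.
Qed.

Lemma hyp_proj_in u : u \in U -> pr u \in W.
Proof.
move=> uU; apply/hyp_orthP; rewrite /pr; split.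
- have -> : u - b u y *: x + b u x *: y = b u x *: y + (- b u y *: x + u).
    by rewrite scaleNr addrC [u - _]addrC.
  by have [_ Uc] := Usub; rewrite !Uc.
- rewrite linearDl linearBl !linearZl_LR /= b_alt byx mulr0 mulrN1 subr0.
  by rewrite subrr.
- by rewrite linearDl linearBl !linearZl_LR /= b_alt bxy mulr0 mulr1 addr0 subrr.
Qed.

Lemma hyp_projK u : u = pr u + b u y *: x - b u x *: y.
Proof. by rewrite /pr addrAC addrK subrK. Qed.

Lemma hyp_proj_id u : u \in W -> pr u = u.
Proof. by move=> /hyp_orthP[_ ux uy]; rewrite /pr ux uy !scale0r subr0 addr0. Qed.

Lemma hyp_proj_form u w : w \in W -> b (pr u) w = b u w.
Proof.
move=> /hyp_orthP[_ wx wy]; rewrite /pr linearDl linearBl !linearZl_LR /=.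
by rewrite (alt_skew x) (alt_skew y) wx wy !oppr0 !mulr0 subr0 addr0.
Qed.

(** If [w] pairs nontrivially with [u] in [W], so does [pr w], since [w - pr w] lies in the plane of
    [x] and [y], to which [u] is orthogonal. *)
Lemma hyp_orth_nondegenerate : nondegenerate U -> nondegenerate W.
Proof.
move=> nd u uW u0; have /hyp_orthP[uU ux uy] := uW.
have [w wU buw] := nd u uU u0; exists (pr w); first exact: hyp_proj_in.
by rewrite alt_skew hyp_proj_form // -alt_skew.
Qed.

(** [U] is the direct sum of [W] and the lines of [x] and [y]; pairing with [y] and [x] recovers the
    two line coordinates. *)
Lemma card_hyp_orth : #|U| = (#|F| ^ 2 * #|W|)%N.
Proof.
pose f (z : F * F * T) := z.2 + z.1.1 *: x + z.1.2 *: y.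
have fx c d w : w \in W -> b (f (c, d, w)) x = - d.
  move=> /hyp_orthP[_ wx wy]; rewrite /f /= !linearDl !linearZl_LR /= wx b_alt.
  by rewrite byx mulr0 mulrN1 !add0r.
have fy c d w : w \in W -> b (f (c, d, w)) y = c.
  move=> /hyp_orthP[_ wx wy]; rewrite /f /= !linearDl !linearZl_LR /= wy b_alt.
  by rewrite bxy mulr0 mulr1 addr0 add0r.
have -> : U = (f @: finset.setX [set: F * F] W)%SET.
  apply/setP => u; apply/idP/imsetP => [uU|[[[c d] w]]].
    exists (b u y, - b u x, pr u).
      by rewrite finset.in_setX finset.in_setT hyp_proj_in.
    by rewrite /f /= scaleNr -hyp_projK.
  rewrite finset.in_setX => /andP[_ /hyp_orthP[wU _ _]] ->; have [_ Uc] := Usub.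
  by rewrite /f /= addrC Uc // addrC Uc.
rewrite card_in_imset ?cardsX ?cardsT ?card_prod //.
move=> [[c d] w] [[c' d'] w']; rewrite !finset.in_setX /= => /andP[_ wW] /andP[_ w'W] e.
have ec : c = c' by rewrite -(fy c d w wW) e fy.
have ed : d = d' by apply: oppr_inj; rewrite -(fx c d w wW) e fx.
by move: e; rewrite /f /= ec ed => /addIr/addIr->.
Qed.

Definition lag_restr L : {set T} := L :&: W.
(** For [M] inside [W] this is the sum of [M] and the line of [x], written as a membership test:
    when [b u x = 0], [u] is [pr u] plus a multiple of [x]. *)
Definition lag_extend M : {set T} := [set u in U | (b u x == 0) && (pr u \in M)]%SET.

Lemma lag_proj L u : L \in lagrangians U -> x \in L -> u \in L ->
  b u x = 0 /\ pr u \in L.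
Proof.
move=> LL xL uL; have ux := lagrangian_isotropic LL uL xL; split=> //.
have [_ Lc] := lagrangian_submod Usub LL.
by rewrite /pr ux scale0r addr0 addrC -scaleNr Lc.
Qed.

(** Every [v] in [L] has its projection in [L :&: W], with the same pairing against [W]; so a vector
    of [W] orthogonal to [L :&: W] is orthogonal to all of [L]. *)
Lemma lag_restr_in L : L \in lagrangians U -> x \in L ->
  lag_restr L \in lagrangians W.
Proof.
move=> LL xL; apply/lagrangianP => u; rewrite finset.in_setI andbC.
have [uW /=|//] := boolP (u \in W); have /hyp_orthP[uU ux uy] := uW.
have /lagrangianP LE := LL.
apply/idP/orthP => [uL v|h].
  by rewrite finset.in_setI => /andP[vL _]; apply: (lagrangian_isotropic LL).
rewrite LE uU; apply/orthP => v vL; have [vx pvL] := lag_proj LL xL vL.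
rewrite -hyp_proj_form // h // finset.in_setI pvL hyp_proj_in //.
by rewrite (fintype.subsetP (lagrangian_sub LL)).
Qed.

Lemma lag_extendP M u : M \in lagrangians W ->
  reflect [/\ u \in U, b u x = 0 & pr u \in M] (u \in lag_extend M).
Proof. by move=> ML; rewrite inE; apply: (iffP and3P) => -[-> /eqP-> ->]; split. Qed.

Lemma mem_lag_extend M : M \in lagrangians W -> x \in lag_extend M.
Proof.
move=> ML; apply/lag_extendP => //; rewrite b_alt; split=> //.
rewrite /pr b_alt bxy scale1r subrr scale0r addr0.
by have [] := lagrangian_submod hyp_orth_submod ML.
Qed.

Lemma lag_extendK M : M \in lagrangians W -> lag_restr (lag_extend M) = M.
Proof.
move=> ML; have MW := fintype.subsetP (lagrangian_sub ML).
apply/setP => u; rewrite finset.in_setI.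
apply/andP/idP => [[/(lag_extendP _ ML)[_ _ pM] uW]|uM].
  by rewrite -(hyp_proj_id uW).
have uW := MW _ uM; split=> //; have /hyp_orthP[uU ux _] := uW.
by apply/lag_extendP; rewrite ?hyp_proj_id.
Qed.

Lemma lag_restrK L : L \in lagrangians U -> x \in L ->
  lag_extend (lag_restr L) = L.
Proof.
move=> LL xL; have RL := lag_restr_in LL xL.
have LU := fintype.subsetP (lagrangian_sub LL).
have [_ Lc] := lagrangian_submod Usub LL.
apply/setP => u; apply/(lag_extendP _ RL)/idP => [[uU ux]|uL].
  rewrite finset.in_setI => /andP[pL _]; rewrite (hyp_projK u) ux scale0r subr0.
  by rewrite addrC Lc.
have [ux pL] := lag_proj LL xL uL.
by rewrite finset.in_setI pL hyp_proj_in ?LU.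
Qed.

Lemma lag_extend_in M : M \in lagrangians W -> lag_extend M \in lagrangians U.
Proof.
move=> ML; have MW := fintype.subsetP (lagrangian_sub ML).
apply/lagrangianP => u; apply/idP/andP => [|[uU /orthP uo]].
  move=> /(lag_extendP _ ML)[uU ux pu]; split=> //; apply/orthP => v.
  move=> /(lag_extendP _ ML)[vU vx pv]; have /hyp_orthP[_ pux _] := MW _ pu.
  rewrite (hyp_projK u) linearBr linearDr !linearZr_LR /= vx ux !mul0r mulr0 !subr0 addr0.
  by rewrite -hyp_proj_form ?MW // (lagrangian_isotropic ML).
(* The extension contains [x] and [M], so a vector orthogonal to it satisfies [b u x = 0] and its
   projection is orthogonal to [M]. *)
have xE := mem_lag_extend ML; have ux : b u x = 0 by rewrite alt_skew uo ?oppr0.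
apply/lag_extendP => //; split=> //.
have /lagrangianP ME := ML; rewrite ME hyp_proj_in //; apply/orthP => m mM.
rewrite alt_skew hyp_proj_form ?MW // -alt_skew; apply: uo.
by move: mM; rewrite -{1}(lag_extendK ML) finset.in_setI => /andP[].
Qed.

(** [L] is the direct sum of the line of [x] and [L :&: W]; pairing with [y] reads off the
    coefficient of [x]. *)
Lemma card_lag_restr L : L \in lagrangians U -> x \in L ->
  #|L| = (#|F| * #|lag_restr L|)%N.
Proof.
move=> LL xL; have LU := fintype.subsetP (lagrangian_sub LL).
have [_ Lc] := lagrangian_submod Usub LL.
pose f (z : F * T) := z.1 *: x + z.2.
have LE : L = (f @: finset.setX [set: F] (lag_restr L))%SET.
  apply/setP => u; apply/idP/imsetP => [uL|[[c w]]].
    have [ux pL] := lag_proj LL xL uL; exists (b u y, pr u).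
      by rewrite finset.in_setX finset.in_setT finset.in_setI pL hyp_proj_in ?LU.
    by rewrite {1}(hyp_projK u) ux scale0r subr0 addrC.
  by rewrite finset.in_setX finset.in_setI => /and3P[_ wL _] ->; apply: Lc.
rewrite {1}LE card_in_imset ?cardsX ?cardsT //.
move=> [c w] [d v]; rewrite !finset.in_setX !finset.in_setI /=.
move=> /and3P[_ _ /hyp_orthP[_ _ wy]] /and3P[_ _ /hyp_orthP[_ _ vy]] e.
have ec : c = d.
  have := congr1 (b^~ y) e; rewrite /f /= !linearDl !linearZl_LR /= bxy wy vy.
  by rewrite !addr0 !mulr1.
by move: e; rewrite /f /= ec => /addrI->.
Qed.

Lemma card_lagrangians_through :
  #|[set L in lagrangians U | x \in L]%SET| = #|lagrangians W|.
Proof.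
rewrite -(card_in_imset (f := lag_restr)).
  apply: eq_card => M; apply/imsetP/idP => [[L]|ML].
    by rewrite inE => /andP[LL xL] ->; apply: lag_restr_in.
  exists (lag_extend M); last by rewrite lag_extendK.
  by rewrite inE lag_extend_in ?mem_lag_extend.
move=> L L'; rewrite inE => /andP[LL xL]; rewrite inE => /andP[LL' xL'] e.
by rewrite -(lag_restrK LL xL) e lag_restrK.
Qed.

End HyperbolicPair.

(** * Size and number of Lagrangians, symplectic bases *)

Local Notation q := #|F|.

Lemma card_field_gt1 : (1 < q)%N.
Proof. exact: finNzRing_gt1. Qed.

Lemma hyperbolic_partner U x : submod_closed U -> nondegenerate U -> x \in U ->
  x != 0 -> exists2 y, y \in U & b x y = 1.
Proof.
move=> [U0 Uc] nd xU x0; have [w wU bw] := nd x xU x0.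
exists ((b x w)^-1 *: w); last by rewrite linearZr_LR /= mulVf.
by rewrite -[_ *: w]addr0 Uc.
Qed.

Lemma card_hyp_orth_exp U x y j : submod_closed U -> x \in U -> y \in U ->
  b x y = 1 -> #|U| = (q ^ (2 * j.+1))%N -> #|hyp_orth U x y| = (q ^ (2 * j))%N.
Proof.
move=> Usub xU yU bxy; rewrite (card_hyp_orth Usub xU yU bxy) mulnS expnD.
by move/eqP; rewrite eqn_pmul2l ?expn_gt0 1?ltnW ?card_field_gt1 // => /eqP.
Qed.

Lemma submod_card1 U : submod_closed U -> #|U| = 1%N -> U = [set 0]%SET.
Proof.
by move=> [U0 _] /eqP/cards1P[z Uz]; move: U0; rewrite Uz inE => /eqP ->.
Qed.

Lemma submod_neq0 U : submod_closed U -> (1 < #|U|)%N -> exists2 x, x \in U & x != 0.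
Proof.
move=> [U0 _] U1; have [/exists_inP[x xU x0]|h] := boolP [exists x in U, x != 0].
  by exists x.
suff /subset_leq_card : U \subset [set 0]%SET by rewrite cards1 leqNgt U1.
apply/fintype.subsetP => x xU; rewrite inE; apply: contraNT h => x0.
by apply/exists_inP; exists x.
Qed.

Lemma orth0 U : U :&: orth [set 0]%SET = U.
Proof.
apply/finset.setIidPl/fintype.subsetP => u uU; apply/orthP => v.
by rewrite inE => /eqP ->; rewrite linear0l.
Qed.

(** The zero subspace is not Lagrangian in a larger [U], because all of [U] is orthogonal to it. *)
Lemma lagrangian_neq0 U L : submod_closed U -> (1 < #|U|)%N ->
  L \in lagrangians U -> exists2 x, x \in L & x != 0.
Proof.
move=> Usub U1 LL; have Lsub := lagrangian_submod Usub LL.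
apply: submod_neq0 => //; have [L0 _] := Lsub.
rewrite ltn_neqAle card_gt0 andbC; apply/andP; split.
  by apply/set0Pn; exists 0.
apply/eqP => /esym /(submod_card1 Lsub) L1; move: LL.
by rewrite inE L1 orth0 => /eqP UE; move: U1; rewrite UE cards1.
Qed.

(** Induction on [j]: splitting off a nonzero [x] of [L] removes a factor [q] from [#|L|] and a
    factor [q ^ 2] from [#|U|]. *)
Lemma card_lagrangian j U L : submod_closed U -> nondegenerate U ->
  #|U| = (q ^ (2 * j))%N -> L \in lagrangians U -> #|L| = (q ^ j)%N.
Proof.
elim: j U L => [|j IH] U L Usub nd cU LL.
  have U1 := submod_card1 Usub cU; have Lsub := lagrangian_submod Usub LL.
  apply/eqP; rewrite expn0 eqn_leq card_gt0; apply/andP; split.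
    by rewrite -(cards1 (0 : T)) -U1 subset_leq_card ?(lagrangian_sub LL).
  by apply/set0Pn; exists 0; case: Lsub.
have U1 : (1 < #|U|)%N by rewrite cU mulnS -{1}(expn0 q) ltn_exp2l ?card_field_gt1.
have [x xL x0] := lagrangian_neq0 Usub U1 LL.
have xU := fintype.subsetP (lagrangian_sub LL) _ xL.
have [y yU bxy] := hyperbolic_partner Usub nd xU x0.
rewrite (card_lag_restr Usub xU yU bxy LL xL) expnS; congr (_ * _)%N.
apply: (IH (hyp_orth U x y)); first exact: hyp_orth_submod.
- exact: hyp_orth_nondegenerate.
- exact: card_hyp_orth_exp.
- exact: lag_restr_in.
Qed.

(** Let [N j] be the count. In rank [j.+1] each Lagrangian has [q ^ j.+1 - 1] nonzero vectors and
    each nonzero vector lies in [N j] Lagrangians, so [N j.+1 * (q ^ j.+1 - 1) = (q ^ (2 * j.+1) -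
    1) * N j], where the first factor on the right is [(q ^ j.+1 - 1) * (q ^ j.+1 + 1)]. *)
Lemma card_lagrangians j U : submod_closed U -> nondegenerate U ->
  #|U| = (q ^ (2 * j))%N ->
  #|lagrangians U| = (\prod_(1 <= i < j.+1) (q ^ i + 1))%N.
Proof.
elim: j U => [|j IH] U Usub nd cU.
  rewrite big_geq //; apply/eqP/cards1P; exists U.
  have U1 := submod_card1 Usub cU.
  apply/setP => L; apply/idP/finset.set1P => [LL|->]; last first.
    by rewrite inE {2}U1 orth0.
  have L0 : 0 \in L by have [] := lagrangian_submod Usub LL.
  apply/eqP; rewrite finset.eqEsubset (lagrangian_sub LL) /= U1.
  by apply/fintype.subsetP => z; rewrite inE => /eqP ->.
have U0 : 0 \in U by have [] := Usub.
have cL : {in lagrangians U, forall L, #|L :&: (U :\ 0)| = (q ^ j.+1).-1}.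
  move=> L LL; rewrite -(card_lagrangian Usub nd cU LL) (cardsD1 0 L).
  have -> : 0 \in L by have [] := lagrangian_submod Usub LL.
  by rewrite add1n /= finset.setIDA (finset.setIidPl (lagrangian_sub LL)).
have cx : {in U :\ 0, forall x, #|[set L in lagrangians U | x \in L]%SET| =
    (\prod_(1 <= i < j.+1) (q ^ i + 1))%N}.
  move=> x; rewrite !inE => /andP[x0 xU].
  have [y yU bxy] := hyperbolic_partner Usub nd xU x0.
  rewrite (card_lagrangians_through Usub xU yU bxy) IH //.
  - exact: hyp_orth_submod.
  - exact: hyp_orth_nondegenerate.
  - exact: card_hyp_orth_exp.
have := double_counting (lagrangians U) (U :\ 0).
rewrite (eq_bigr _ cL) (eq_bigr _ cx) !sum_nat_const.
have -> : #|U :\ 0| = ((q ^ j.+1).-1 * (q ^ j.+1 + 1))%N.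
  have := cardsD1 0 U; rewrite U0 cU add1n => /(congr1 predn) /= <-.
  by rewrite mulnC expnM -subn1 -[in RHS]subn1 -{2}(exp1n 2) subn_sqr.
have qj : (0 < (q ^ j.+1).-1)%N.
  by rewrite -subn1 subn_gt0 -{1}(expn0 q) ltn_exp2l ?card_field_gt1.
rewrite mulnC -mulnA => /eqP; rewrite eqn_pmul2l // => /eqP ->.
by rewrite [RHS]big_nat_recr //= mulnC.
Qed.

Lemma card_lagrangians_nonzero j U x : submod_closed U -> nondegenerate U ->
  #|U| = (q ^ (2 * j.+1))%N -> x \in U -> x != 0 ->
  #|[set L in lagrangians U | x \in L]%SET| = (\prod_(1 <= i < j.+1) (q ^ i + 1))%N.
Proof.
move=> Usub nd cU xU x0; have [y yU bxy] := hyperbolic_partner Usub nd xU x0.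
rewrite (card_lagrangians_through Usub xU yU bxy); apply: card_lagrangians.
- exact: hyp_orth_submod.
- exact: hyp_orth_nondegenerate.
- exact: card_hyp_orth_exp.
Qed.

(** A maximal isotropic superset of [S] works: a vector orthogonal to it could be added, the form
    being alternating. [S] is an arbitrary set, not assumed to be a subspace. *)
Lemma isotropic_sub_lagrangian S : {in S &, forall u v, b u v = 0} ->
  exists2 L, L \in lagrangians [set: T] & S \subset L.
Proof.
pose iso (A : {set T}) := [forall u in A, forall v in A, b u v == 0].
have isoP (A : {set T}) : reflect {in A &, forall u v, b u v = 0} (iso A).
  apply: (iffP forall_inP) => [h u v uA vA|h u uA].
    by apply/eqP/(forall_inP (h u uA)).
  by apply/forall_inP => v vA; apply/eqP/h.
move=> /isoP /maxset_exists[L /maxsetP[/isoP isoL Lmax] SL]; exists L => //.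
apply/lagrangianP => v; rewrite finset.in_setT /=.
apply/idP/idP => [vL|/orthP vo]; first by apply/orthP => u uL; apply: isoL.
rewrite -(Lmax (v |: L)) ?setU11 ?finset.subsetUr //; apply/isoP => u w.
move=> /setU1P[->|uL] /setU1P[->|wL]; rewrite ?b_alt ?(vo u) ?(isoL u w) //.
by rewrite alt_skew (vo w) ?oppr0.
Qed.

(** A hyperbolic pair goes to index 0, and the induction hypothesis in its orthogonal complement
    supplies the rest, shifted by one. Only the values below [j] carry information. *)
Lemma symplectic_basis j U : submod_closed U -> nondegenerate U ->
  #|U| = (q ^ (2 * j))%N ->
  exists e f : nat -> T, forall i k, (i < j)%N -> (k < j)%N ->
    [/\ e i \in U /\ f i \in U, b (e i) (e k) = 0, b (f i) (f k) = 0
      & b (e i) (f k) = (i == k)%:R].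
Proof.
elim: j U => [|j IH] U Usub nd cU; first by exists (fun=> 0), (fun=> 0).
have U1 : (1 < #|U|)%N by rewrite cU mulnS -{1}(expn0 q) ltn_exp2l ?card_field_gt1.
have [x xU x0] := submod_neq0 Usub U1.
have [y yU bxy] := hyperbolic_partner Usub nd xU x0.
have [e [f h]] := IH _ (hyp_orth_submod x y Usub)
  (hyp_orth_nondegenerate Usub xU yU bxy nd) (card_hyp_orth_exp Usub xU yU bxy cU).
exists (fun i => if i is i'.+1 then e i' else x).
exists (fun i => if i is i'.+1 then f i' else y).
have eW i : (i < j)%N -> [/\ e i \in U, b (e i) x = 0 & b (e i) y = 0].
  by move=> ij; have [[/hyp_orthP]] := h i i ij ij.
have fW i : (i < j)%N -> [/\ f i \in U, b (f i) x = 0 & b (f i) y = 0].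
  by move=> ij; have [[_ /hyp_orthP]] := h i i ij ij.
case=> [|i] [|k] /=; rewrite ?ltnS => ij kj; first by rewrite !b_alt.
- have [ek ex ey] := eW k kj; have [fk fx fy] := fW k kj.
  by rewrite !(alt_skew x) (alt_skew y) ex fx fy !oppr0.
- have [ei ex ey] := eW i ij; have [fi fx fy] := fW i ij.
  by rewrite ex ey fy.
- by have [[/hyp_orthP[? _ _] /hyp_orthP[? _ _]] ? ? ?] := h i k ij kj.
Qed.

End Isotropic.

(** * Designs of translates *)

Section Translates.
Variable T : finZmodType.
Implicit Types (x y v : T) (L K : {set T}) (D : {set {set T}}).

Definition translate v L : {set T} := [set v + x | x in L]%SET.
Definition translates D : {set {set T}} :=
  [set translate v L | v in [set: T], L in D]%SET.

Lemma mem_translate v L x : (x \in translate v L) = (x - v \in L).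
Proof.
rewrite /translate; apply/imsetP/idP => [[z zL ->]|xL]; first by rewrite addrC addKr.
by exists (x - v); rewrite // addrC subrK.
Qed.

Lemma card_translate v L : #|translate v L| = #|L|.
Proof. by rewrite card_imset //; apply: addrI. Qed.

Lemma translate_inj v : injective (translate v).
Proof.
move=> L L' e; apply/setP => x; have := congr1 (fun K => v + x \in K) e.
by rewrite !mem_translate addrC addKr.
Qed.

Variables (D : {set {set T}}) (k lam : nat).
Hypothesis D_zmod : {in D, forall L, zmod_closed L}.
Hypothesis D_card : {in D, forall L, #|L| = k}.
Hypothesis D_lam : forall x, x != 0 -> #|[set L in D | x \in L]%SET| = lam.

Lemma translate_base v L x : L \in D -> x \in translate v L ->
  translate v L = translate x L.
Proof.
move=> /D_zmod[L0 Lc]; rewrite mem_translate => xv; apply/setP => y.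
rewrite !mem_translate; apply/idP/idP => h.
  by have := Lc _ _ h xv; rewrite opprB addrA subrK.
by have := Lc _ _ h (Lc _ _ L0 xv); rewrite sub0r opprK addrA subrK.
Qed.

(** Each [L] in [D] has exactly one translate through [x], namely [translate x L]. The predicate [p]
    lets one bijection serve both for the blocks through a point and for those through a pair. *)
Lemma translates_through x (p : pred {set T}) :
  #|[set K in translates D | (x \in K) && p K]%SET| =
  #|[set L in D | p (translate x L)]%SET|.
Proof.
rewrite -[RHS](card_imset _ (@translate_inj x)); apply: eq_card => K.
apply/idP/imsetP => [|[L LD ->]]; rewrite inE.
  case/and3P => /imset2P[v L _ LD ->] xK pK; exists L.
    by rewrite inE LD -(translate_base LD xK).
  exact: translate_base.
move: LD; rewrite inE => /andP[LD pL]; rewrite pL andbT mem_translate subrr.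
have [-> _] := D_zmod LD; rewrite andbT.
by apply/imset2P; exists x L; rewrite ?finset.in_setT.
Qed.

(** Each point lies on one translate of each [L]; [x] and [y] share a translate of [L] exactly when
    [y - x] is in [L]. *)
Lemma translates_bibd c : (2 <= k)%N -> (0 < c)%N -> (c * k = #|T| * #|D|)%N ->
  forms_bibd (translates D) #|T| k lam #|D| c.
Proof.
move=> k2 c0 ck.
have cnt (p : pred {set T}) :
    count p (enum (translates D)) = #|[set K in translates D | p K]%SET|.
  rewrite -size_filter -(card_uniqP (filter_uniq _ (enum_uniq _))).
  by apply: eq_card => K; rewrite inE mem_filter mem_enum andbC.
have tk : {in translates D, forall K, #|K| = k}.
  by move=> K /imset2P[v L _ LD ->]; rewrite card_translate D_card.
have r x : #|[set K in translates D | x \in K]%SET| = #|D|.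
  transitivity #|[set K in translates D | (x \in K) && true]%SET|.
    by apply: eq_card => K; rewrite !inE andbT.
  rewrite (translates_through x xpredT); apply: eq_card => L.
  by rewrite inE andbT.
exists (enum (translates D)); split; first exact: enum_uniq.
  exact: mem_enum.
split=> //.
(* Counting incidences, the number of blocks times [k] equals [#|T| * #|D|], which is [c * k]. *)
- split=> //; apply/eqP; rewrite -(@eqn_pmul2r k) ?(ltnW k2) // ck -cardE.
  have := double_counting (translates D) [set: T].
  under eq_bigr => K KX do rewrite finset.setIT tk //.
  under [RHS]eq_bigr => x _ do rewrite r.
  by rewrite !sum_nat_const cardsT => ->.
- by split=> // K; rewrite mem_enum => /tk.
- move=> x y xy; rewrite cnt (translates_through x (fun K => y \in K)).
  have yx : y - x != 0 by rewrite subr_eq0 eq_sym.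
  rewrite -(D_lam yx); apply: eq_card => L.
  by rewrite !inE mem_translate.
- by move=> x; rewrite cnt r.
Qed.

End Translates.

(** * Lagrangian spreads *)

Section SymplecticSpace.
Variables (F : finFieldType) (T : finLmodType F) (b : {biscalar T}) (J : nat).
Hypothesis b_alt : forall v, b v v = 0.
Hypothesis b_nd : forall v, v != 0 -> exists w, b v w != 0.
Hypothesis card_T : #|T| = (#|F| ^ (2 * J))%N.
Local Notation q := #|F|.
Local Notation lagr := (lagrangians b [set: T]).

Lemma setT_submod : submod_closed ([set: T] : {set T}).
Proof. by split=> [|a u v _ _]; rewrite finset.in_setT. Qed.

Lemma setT_nondegenerate : nondegenerate b [set: T].
Proof. by move=> u _ /b_nd[w bw]; exists w; rewrite ?finset.in_setT. Qed.

Let card_setT : #|[set: T]| = (q ^ (2 * J))%N.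
Proof. by rewrite cardsT. Qed.

(** [S] extends to a Lagrangian, which also has [q ^ J] elements; linearity of [S] comes out as a
    consequence. *)
Lemma isotropic_lagrangian (S : {set T}) : {in S &, forall u v, b u v = 0} ->
  #|S| = (q ^ J)%N -> S \in lagr.
Proof.
move=> /(isotropic_sub_lagrangian b_alt)[L LL SL] cS.
suff -> : S = L by [].
apply/eqP; rewrite eqEcard SL cS.
have -> := card_lagrangian b_alt setT_submod setT_nondegenerate card_setT LL.
by rewrite leqnn.
Qed.

Lemma lagrangian_zmod L : L \in lagr -> zmod_closed L.
Proof.
move=> LL; have [L0 Lc] := lagrangian_submod setT_submod LL.
by split=> // x y xL yL; rewrite addrC -scaleN1r Lc.
Qed.

(* The two Lagrangians spanned by a symplectic basis are identified with a
   degree [J] extension field [E] so that the form becomes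
   [(x, y), (x', y') |-> lam (x * y' - x' * y)] with [lam] linear; the [E]-lines
   of [E ^ 2] then form a spread. *)
Lemma lagrangian_spread (E : fieldExtType F) : (0 < J)%N -> \dim {:E} = J ->
  exists D : {set {set T}}, [/\ D \subset lagr, #|D| = (q ^ J + 1)%N
    & forall x, x != 0 -> #|[set L in D | x \in L]%SET| = 1%N].
Proof.
move=> J0 dE.
have [e [f ef]] := symplectic_basis b_alt setT_submod setT_nondegenerate card_setT.
pose bs := vbasis {:E}.
(* The first basis vector exists since [0 < J]; [lam] is the coordinate on it, and what matters is
   that [lam] is a nonzero linear functional. *)
pose i0 : 'I_(\dim {:E}) := Ordinal (eq_ind_r (fun n => 0 < n)%N J0 dE).
have free_bs : free bs := basis_free (vbasisP _).
pose lam : E -> F := coord bs i0.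
(* [g] uses the coordinates in [bs] and [h] those in the basis dual to [bs] for the pairing
   [lam (x * y)], so that [b (g x) (h y)] sums to [lam (x * y)]. *)
pose g (x : E) : T := \sum_(i < \dim {:E}) coord bs i x *: e i.
pose h (x : E) : T := \sum_(i < \dim {:E}) lam (bs`_i * x) *: f i.
have gD : {morph g : x y / x - y}.
  move=> x y; rewrite /g -sumrB; apply: eq_bigr => i _.
  by rewrite linearB scalerBl.
have hD : {morph h : x y / x - y}.
  move=> x y; rewrite /h -sumrB; apply: eq_bigr => i _.
  by rewrite /lam mulrBr linearB scalerBl.
have ordJ (i : 'I_(\dim {:E})) : (i < J)%N by rewrite -dE.
have bgg x y : b (g x) (g y) = 0.
  rewrite /g linear_sumlz big1 // => i _; rewrite linear_sumr big1 // => k _.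
  rewrite linearZl_LR linearZr_LR /=.
  by have [_ -> _ _] := ef i k (ordJ i) (ordJ k); rewrite !mulr0.
have bhh x y : b (h x) (h y) = 0.
  rewrite /h linear_sumlz big1 // => i _; rewrite linear_sumr big1 // => k _.
  rewrite linearZl_LR linearZr_LR /=.
  by have [_ _ -> _] := ef i k (ordJ i) (ordJ k); rewrite !mulr0.
have bgh x y : b (g x) (h y) = lam (x * y).
  rewrite /g /h linear_sumlz {2}(coord_vbasis (memvf x)) mulr_suml /lam linear_sum.
  apply: eq_bigr => i _; rewrite linear_sumr (bigD1 i) //= big1 => [|k ki].
    rewrite linearZl_LR linearZr_LR /= -scalerAl linearZ /=.
    have [_ _ _ ->] := ef i i (ordJ i) (ordJ i).
    by rewrite eqxx mulr1 addr0.
  rewrite linearZl_LR linearZr_LR /=.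
  have [_ _ _ ->] := ef i k (ordJ i) (ordJ k).
  by rewrite eq_sym val_eqE (negbTE ki) !mulr0.
have bhg x y : b (h y) (g x) = - lam (x * y) by rewrite alt_skew // bgh.
(* The pairing is nondegenerate because [E] is a field: a nonzero [x] has the basis vector on which
   [lam] is 1 among its multiples. *)
have lam_nd x : (forall y, lam (x * y) = 0) -> x = 0.
  move=> lx; apply/eqP/negP => /negP x0.
  have := lx (x^-1 * bs`_i0); rewrite mulrA mulfV // mul1r /lam coord_free // eqxx.
  by move/eqP; rewrite oner_eq0.
have gh_inj x y : g x + h y = 0 -> x = 0 /\ y = 0.
  move=> gh0; split; apply: lam_nd => t.
    by have := congr1 (b^~ (h t)) gh0; rewrite /= linearDl linear0l /= bhh addr0 bgh.
  have := congr1 (b (g t)) gh0; rewrite /= linearDr linear0r /= bgg add0r bgh.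
  by rewrite mulrC.
pose Ef := finvect_type E.
have cE : #|Ef| = (q ^ J)%N.
  by rewrite -dE -(@card_vspace _ Ef); apply: eq_card => x; rewrite memvf.
pose gh (z : Ef * Ef) : T := g z.1 + h z.2.
have ghinj : injective gh.
  move=> [x y] [x' y'] /= /eqP; rewrite -subr_eq0 /gh /= opprD addrACA -gD -hD.
  by move=> /eqP/gh_inj[/eqP + /eqP]; rewrite !subr_eq0 => /eqP-> /eqP->.
(* Injectivity suffices, both sides having [q ^ (2 * J)] elements. *)
have ghsurj z : exists x y : E, z = g x + h y.
  have : z \in codom gh.
    by apply: inj_card_onto => //; rewrite card_T card_prod cE -expnD addnn mul2n.
  by move=> /codomP[[x y] ->]; exists x, y.
(* The lines through the origin of [E ^ 2]: [ray a] has slope [a], and [inf] is the vertical one. *)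
pose ray (a : Ef) : {set T} := [set g x + h ((a : E) * x) | x : Ef]%SET.
pose inf : {set T} := [set h x | x : Ef]%SET.
have h0 : h 0 = 0 by rewrite -(subrr 0) hD subrr.
have g0 : g 0 = 0 by rewrite -(subrr 0) gD subrr.
have in_ray a (x y : E) : (g x + h y \in ray a) = (y == (a : E) * x).
  apply/imsetP/eqP => [[t _ e1]|->]; last by exists x.
  by have /ghinj[-> ->] : gh (x, y) = gh (t, (a : E) * t).
have in_inf (x y : E) : (g x + h y \in inf) = (x == 0).
  apply/imsetP/eqP => [[t _ e1]|->]; last by exists y; rewrite // g0 add0r.
  by have /ghinj[-> _] : gh (x, y) = gh (0, t) by rewrite /gh /= e1 g0 add0r.
exists (inf |: [set ray a | a : Ef])%SET; split.
- apply/fintype.subsetP => L /setU1P[->|/imsetP[a _ ->]]; apply: isotropic_lagrangian.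
  + by move=> _ _ /imsetP[x _ ->] /imsetP[y _ ->].
  + rewrite card_imset ?cardsT // => x y hxy.
    by have /ghinj[] : gh (0, x) = gh (0, y) by rewrite /gh /= hxy.
  (* The cross terms [lam (x * (a * y))] and [- lam (y * (a * x))] cancel because [E] is
     commutative. *)
  + move=> _ _ /imsetP[x _ ->] /imsetP[y _ ->]; rewrite linearDl !linearDr /=.
    by rewrite bgg bhh bgh bhg addr0 add0r mulrCA (mulrCA y) (mulrC x) subrr.
  + rewrite card_imset ?cardsT // => x y hxy.
    by have /ghinj[] : gh (x, (a : E) * x) = gh (y, (a : E) * y) by [].
- rewrite cardsU1 card_imset ?cardsT ?cE.
    case: imsetP => [[a _ ia]|_]; last by rewrite addnC.
    by have := in_inf 0 1; rewrite ia in_ray mulr0 eqxx oner_eq0.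
  move=> a a' raa; have := in_ray a' 1 a; rewrite -raa in_ray !mulr1 eqxx.
  by move=> /esym/eqP.
- move=> z; have [x [y ->]] := ghsurj z => nz.
  (* The only line through a nonzero [(x, y)] is [inf] if [x = 0] and [ray (y / x)] otherwise. *)
  have [x0|x0] := eqVneq x 0.
    rewrite -(cards1 inf); apply: eq_card => L; rewrite inE finset.in_set1.
    apply/andP/eqP => [[/setU1P[//|/imsetP[a _ ->]]]|->]; last first.
      by rewrite finset.setU11 in_inf x0.
    rewrite in_ray x0 mulr0 => /eqP y0.
    by move: nz; rewrite x0 y0 g0 h0 addr0 eqxx.
  rewrite -(cards1 (ray (y / x))); apply: eq_card => L; rewrite inE finset.in_set1.
  apply/andP/eqP => [[/setU1P[->|/imsetP[a _ ->]]]|->].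
  + by rewrite in_inf (negbTE x0).
  + by rewrite in_ray => /eqP ->; rewrite mulfK.
  + by rewrite in_ray divfK // eqxx setU1r // imset_f.
Qed.

End SymplecticSpace.

(** The field of order [P ^ J] serves; its degree over ['F_P] is read off from its cardinality. *)
Lemma prime_field_extension (P J : nat) : prime P -> (0 < J)%N ->
  exists E : fieldExtType 'F_P, \dim {:E} = J.
Proof.
move=> Pp J0; have [Fm chFm cFm] := PrimePowerField Pp J0.
pose E : fieldExtType 'F_P := pPrimeCharType chFm.
exists E; have := @card_vspace _ (pPrimeCharType chFm) _ ({:E})%VS.
have -> : #|{:E}%VS| = #|Fm| by apply: eq_card => x; rewrite (@memvf _ E).
by rewrite cFm card_Fp // => /eqP; rewrite eqn_exp2l ?prime_gt1 // => /eqP ->.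
Qed.

(** * Regular simplices *)

(** A full-rank factorization of [A] passes through dimension at most one, so its entries are
    products of a row factor and a column factor, or all zero. *)
Lemma rank_le1_minor (F : fieldType) m n (A : 'M[F]_(m, n)) i j k l :
  (\rank A <= 1)%N -> A i j * A k l = A i l * A k j.
Proof.
have minor r (u : 'M[F]_(m, r)) (v : 'M[F]_(r, n)) : (r <= 1)%N ->
    (u *m v) i j * (u *m v) k l = (u *m v) i l * (u *m v) k j.
  case: r u v => [|[|//]] u v _; first by rewrite !mxE !big_ord0 !mul0r.
  by rewrite !mxE !big_ord1; ring.
by move=> rA; rewrite -(mulmx_base A) minor.
Qed.

Section Simplex.
Variables (R : realType) (F : scalars R) (H : hilbert F) (N : finType).
Implicit Types (psi : N -> H) (K : {set N}).

Lemma inner_sumr (I : Type) (r : seq I) (P : pred I) (c : I -> F) (f : I -> H) x :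
  inner x (\sum_(i <- r | P i) c i *: f i) = \sum_(i <- r | P i) c i * inner x (f i).
Proof.
by rewrite /inner linear_sumlz; apply: eq_bigr => i _; rewrite linearZl_LR.
Qed.

Lemma inner_suml (I : Type) (r : seq I) (P : pred I) (c : I -> F) (f : I -> H) x :
  inner (\sum_(i <- r | P i) c i *: f i) x =
  \sum_(i <- r | P i) sconj F (c i) * inner (f i) x.
Proof.
by rewrite /inner linear_sumr; apply: eq_bigr => i _; rewrite linearZr_LR.
Qed.

Lemma inner0r (x : H) : inner x 0 = 0.
Proof. by rewrite /inner linear0l. Qed.

Lemma innerZr (x y : H) a : inner x (a *: y) = a * inner x y.
Proof. by rewrite /inner linearZl_LR. Qed.

Lemma inner_eq0 (x : H) : inner x x = 0 -> x = 0.
Proof. by rewrite /inner hdotE => /eqP; rewrite expf_eq0 normr_eq0 => /eqP. Qed.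

Lemma family_span_enum psi K :
  family_span K psi =
  family_span [set: 'I_#|K|]%SET (fun i => psi (enum_val i)).
Proof.
apply/seteqP; split=> y [c ->] /=.
  exists (fun i => c (enum_val i)); rewrite big_enum_val.
  by apply: eq_bigl => i; rewrite finset.in_setT.
have cs : \sum_(i in [set: 'I_#|K|]%SET) c i *: psi (enum_val i) =
    \sum_i c i *: psi (enum_val i).
  by apply: eq_bigl => i; rewrite finset.in_setT.
have [K0|[n0 n0K]] := set_0Vmem K.
  exists (fun=> 0); rewrite cs !big1 // => [n _|i _]; first by rewrite scale0r.
  by have := enum_valP i; rewrite {2}K0 finset.in_set0.
exists (fun n => c (enum_rank_in n0K n)); rewrite cs [RHS]big_enum_val.
by apply: eq_bigr => i _; rewrite enum_valK_in.
Qed.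

Lemma mem_family_span psi K n : n \in K -> family_span K psi (psi n).
Proof.
move=> nK; exists (fun m => (m == n)%:R); rewrite (bigD1 n) //= eqxx scale1r.
by rewrite big1 ?addr0 // => m /andP[_ /negbTE ->]; rewrite scale0r.
Qed.

(** * From a regular simplex to its Gram matrix *)

Section Necessary.
Variables (psi : N -> H) (K : {set N}) (q : nat) (e : N -> N -> F).
Hypothesis q_gt1 : (1 < q)%N.
Hypothesis psi_norm : forall n, inner (psi n) (psi n) = q%:R - 1.
Hypothesis psi_inner : forall n1 n2, n1 != n2 -> inner (psi n1) (psi n2) = - e n1 n2.
Hypothesis e_diag : forall n, e n n = 1.
Hypothesis e_inv : forall n1 n2, e n1 n2 * e n2 n1 = 1.

(* The Gram matrix [G] of a tight frame satisfies [G ^ 2 = A G], so when it has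
   corank one all the 2 x 2 minors of [A - G] vanish. *)
Lemma simplex_gram_minors A :
  (forall y, family_span K psi y ->
     \sum_(n in K) inner (psi n) y *: psi n = A *: y) ->
  K != finset.set0 -> has_dim (family_span K psi) (#|K| - 1)%N ->
  let E i j := A * (i == j)%:R - inner (psi i) (psi j) in
  {in K & K, forall i j, {in K & K, forall k l, E i j * E k l = E i l * E k j}}.
Proof.
move=> tight K0 [bs [indep spanE]] E.
pose x (i : 'I_#|K|) := enum_val i.
have xK i : x i \in K by apply: enum_valP.
(* [M] expresses the frame vectors in the basis [bs] and [L] expresses [bs] in the frame vectors;
   hence [LL *m MM] is the identity and [MM] has rank [#|K| - 1]. *)
have /boolp.choice[M ME] i :
    exists c : 'I_(#|K| - 1) -> F, psi (x i) = \sum_j c j *: bs j.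
  have : family_span K psi (psi (x i)) by apply: mem_family_span.
  rewrite spanE => -[c ->]; exists c.
  by apply: eq_bigl => j; rewrite finset.in_setT.
have /boolp.choice[L LE] j :
    exists c : 'I_#|K| -> F, bs j = \sum_i c i *: psi (x i).
  have : family_span [set: 'I_(#|K| - 1)]%SET bs (bs j).
    exists (fun m => (m == j)%:R); rewrite (bigD1 j) ?finset.in_setT //= eqxx scale1r.
    by rewrite big1 ?addr0 // => m /andP[_ /negbTE ->]; rewrite scale0r.
  rewrite -spanE family_span_enum => -[c ->]; exists c.
  by apply: eq_bigl => i; rewrite finset.in_setT.
pose MM := \matrix_(i, j) M i j; pose LL := \matrix_(j, i) L j i.
have comb (c : 'I_#|K| -> F) :
    \sum_i c i *: psi (x i) = \sum_j (\sum_i c i * M i j) *: bs j.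
  under eq_bigr => i _ do rewrite ME scaler_sumr.
  rewrite exchange_big; apply: eq_bigr => j _; rewrite scaler_suml.
  by apply: eq_bigr => i _; rewrite scalerA.
have LM : LL *m MM = 1%:M.
  apply/matrixP => j k; rewrite !mxE; apply/eqP; rewrite -subr_eq0; apply/eqP.
  rewrite -[RHS](indep (fun k => (LL *m MM) j k - (j == k)%:R) _ k).
    by rewrite !mxE.
  under eq_bigr => m _ do rewrite scalerBl.
  have -> : \sum_k ((LL *m MM) j k *: bs k - (j == k)%:R *: bs k) =
      \sum_k (LL *m MM) j k *: bs k - bs j.
    rewrite sumrB; congr (_ - _); rewrite (bigD1 j) //= eqxx scale1r big1 ?addr0 //.
    by move=> m mj; rewrite eq_sym (negbTE mj) scale0r.
  apply/eqP; rewrite subr_eq0; apply/eqP; rewrite [RHS]LE comb.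
  apply: eq_bigr => m _; congr (_ *: _); rewrite mxE.
  by apply: eq_bigr => i _; rewrite !mxE.
(* The transpose of [A - G], so that its rows hold the coefficients of relations among the frame
   vectors: row [i] is tightness at [psi (x i)]. *)
pose EE := \matrix_(i, j) E (x j) (x i).
have EM : EE *m MM = 0.
  apply/matrixP => i k; rewrite mxE [RHS]mxE.
  rewrite -[RHS](indep (fun k => \sum_j E (x j) (x i) * M j k) _ k).
    by apply: eq_bigr => j _; rewrite !mxE.
  rewrite -comb /E.
  under eq_bigr => j _ do rewrite scalerBl.
  rewrite sumrB -(big_enum_val (fun n => inner (psi n) (psi (x i)) *: psi n)).
  rewrite tight; last exact: mem_family_span.
  rewrite (bigD1 i) //= eqxx mulr1 big1 ?addr0 ?subrr //.
  by move=> j ji; rewrite (inj_eq enum_val_inj) (negbTE ji) mulr0 scale0r.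
(* The rows of [EE] lie in the left kernel of [MM], whose dimension [#|K| - (#|K| - 1)] is 1 as [K]
   is nonempty. *)
have rE : (\rank EE <= 1)%N.
  have rM : \rank MM = (#|K| - 1)%N.
    by apply/eqP; rewrite -/(row_full MM); apply/row_fullP; exists LL.
  have /mxrankS : (EE <= kermx MM)%MS by apply/sub_kermxP.
  rewrite mxrank_ker rM => /leq_trans; apply.
  by rewrite subKn // card_gt0.
move=> i j iK jK k l kK lK.
have rank_in n : n \in K -> exists m, n = x m.
  by move=> nK; exists (enum_rank_in nK n); rewrite /x enum_rankK_in.
have [[i' ->] [j' ->]] := (rank_in _ iK, rank_in _ jK).
have [[k' ->] [l' ->]] := (rank_in _ kK, rank_in _ lK).
by have := rank_le1_minor j' i' l' k' rE; rewrite !mxE => ->; rewrite mulrC.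
Qed.

Lemma regular_simplex_gram : regular_simplex psi K ->
  #|K| = q /\ {in K & K, forall i j, {in K, forall k, e i j = e i k * e k j}}.
Proof.
move=> [[K0 _ _ [A A0 tight]] dimK]; have := simplex_gram_minors tight K0 dimK.
set E := fun i j => _ => minors.
have Ediag n : E n n = A - (q%:R - 1) by rewrite /E eqxx mulr1 psi_norm.
have Eoff i j : i != j -> E i j = e i j.
  by move=> ij; rewrite /E (negbTE ij) mulr0 psi_inner // sub0r opprK.
have q1 : 0 < q%:R - 1 :> F by rewrite subr_gt0 ltr1n.
have [i0 i0K] := set0Pn _ K0.
(* Pair the tightness identity at [psi i0] with [psi i0]: the term at [i0] contributes [(q - 1) ^ 2]
   and each other term [e i0 n * e n i0 = 1]. *)
have tr : (A - (q%:R - 1)) * (q%:R - 1) = (#|K| - 1)%:R.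
  have := congr1 (inner (psi i0)) (tight _ (mem_family_span psi i0K)).
  rewrite inner_sumr innerZr psi_norm mulrBl => <-.
  rewrite (bigD1 i0) //= psi_norm addrAC subrr add0r.
  rewrite (eq_bigr (fun=> 1)) => [|n /andP[_ ni]]; last first.
    by rewrite !psi_inner // 1?eq_sym // mulrNN e_inv.
  rewrite sumr_const; congr (_%:R); rewrite (cardsD1 i0 K) i0K addKn.
  by apply: eq_card => n; rewrite !inE andbC.
(* A single vector would span dimension 0, yet its squared norm [q - 1] is positive. *)
have [K1|K1] := leqP #|K| 1.
  have [bs [_ spanE]] := dimK.
  have := mem_family_span psi i0K; rewrite spanE => -[c].
  rewrite big1 => [p0|[j jK]]; last by exfalso; move: jK; rewrite (eqP K1).
  by have := q1; rewrite -(psi_norm i0) p0 inner0r ltxx.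
have [j0 j0K] : exists2 j0, j0 \in K & j0 != i0.
  have : (0 < #|K :\ i0|)%N by move: K1; rewrite (cardsD1 i0 K) i0K.
  by rewrite card_gt0 => /set0Pn[j]; rewrite !inE => /andP[? ?]; exists j.
move=> ji.
(* The minor on [i0] and [j0] makes the diagonal entry of [E] square to 1; [tr] then excludes -1, as
   [#|K| - 1] and [q - 1] are positive. *)
have t2 : (A - (q%:R - 1)) ^+ 2 = 1.
  have := minors i0 j0 i0K j0K j0 i0 j0K i0K.
  by rewrite !Ediag !Eoff // 1?eq_sym // e_inv expr2 => <-.
have t1 : A - (q%:R - 1) = 1.
  move/eqP: t2; rewrite sqrf_eq1 => /orP[/eqP //|/eqP tN].
  have : 0 < (#|K| - 1)%:R :> F by rewrite ltr0n subn_gt0.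
  by rewrite -tr tN mulN1r oppr_gt0 => /(lt_trans q1); rewrite ltxx.
have Ee i j : E i j = e i j.
  by have [->|/Eoff //] := eqVneq i j; rewrite Ediag t1 e_diag.
split.
  move: tr; rewrite t1 mul1r -[1]/(1%:R) -natrB ?(ltnW q_gt1) // => /eqP.
  rewrite eqr_nat => /eqP e1.
  by rewrite -(subnK (ltnW K1)) -e1 subnK // ltnW.
(* With [E k k = 1], the minor through [k] is the cocycle identity for [e]. *)
move=> i j iK jK k kK; have := minors i j iK jK k k kK kK.
by rewrite !Ee e_diag mulr1.
Qed.

End Necessary.

(** * From the Gram matrix to a regular simplex *)

Section Sufficient.
Variables (psi : N -> H) (K : {set N}) (q : nat) (u : N -> F).
Hypothesis q_gt1 : (1 < q)%N.
Hypothesis card_K : #|K| = q.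
Hypothesis u_norm : forall n, `|u n| = 1.
Hypothesis u_conj : forall n, sconj F (u n) * u n = 1.
Hypothesis gram : {in K & K, forall i j,
  inner (psi i) (psi j) = q%:R * (i == j)%:R - sconj F (u i) * u j}.

Let inner_comb (c : N -> F) n : n \in K ->
  inner (psi n) (\sum_(m in K) c m *: psi m) =
  q%:R * c n - sconj F (u n) * \sum_(m in K) c m * u m.
Proof.
move=> nK; rewrite inner_sumr.
rewrite (eq_bigr (fun m => q%:R * (c m * (n == m)%:R) - sconj F (u n) * (c m * u m))).
  rewrite sumrB -!mulr_sumr; congr (_ * _ - _).
  rewrite (bigD1 n) //= eqxx mulr1 big1 ?addr0 // => m /andP[_ mn].
  by rewrite eq_sym (negbTE mn) mulr0.
by move=> m mK; rewrite gram //; ring.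
Qed.

(* The conjugate of [u] is the null vector of the Gram matrix. *)
Let null_comb : \sum_(n in K) sconj F (u n) *: psi n = 0.
Proof.
apply: inner_eq0; rewrite inner_suml big1 // => n nK.
rewrite inner_comb // (eq_bigr (fun=> 1)) => [|m _]; last exact: u_conj.
by rewrite sumr_const card_K; ring.
Qed.

(** The Gram matrix is [q] times the identity minus a rank-one term. In the frame sum that term
    contributes a multiple of the relation [null_comb], which vanishes, so the frame constant is
    [q]. *)
Lemma simplex_is_etf : is_etf psi K.
Proof.
have q0 : 0 < q%:R :> F by rewrite ltr0n ltnW.
have u_conj_norm n : `|sconj F (u n)| = 1.
  by have := congr1 Num.norm (u_conj n); rewrite normrM u_norm mulr1 normr1.
split.
- by rewrite -card_gt0 card_K ltnW.
- exists (q%:R - 1); first by rewrite subr_gt0 ltr1n.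
  by move=> n nK; rewrite -hdotE -/(inner _ _) gram // eqxx mulr1 u_conj.
- exists 1 => // i j iK jK ij; rewrite gram // (negbTE ij) mulr0 sub0r normrN.
  by rewrite normrM u_norm u_conj_norm mulr1 expr1n.
- exists q%:R => // y [c ->].
  rewrite (eq_bigr (fun n => q%:R *: (c n *: psi n) -
      (\sum_(m in K) c m * u m) *: (sconj F (u n) *: psi n))); last first.
    by move=> n nK; rewrite inner_comb // scalerBl !scalerA [_ * sconj F _]mulrC.
  by rewrite sumrB -!scaler_sumr null_comb scaler0 subr0.
Qed.

Lemma simplex_has_dim : has_dim (family_span K psi) (#|K| - 1)%N.
Proof.
have [m0 m0K] : exists m0, m0 \in K by apply/set0Pn; rewrite -card_gt0 card_K ltnW.
have <- : #|K :\ m0| = (#|K| - 1)%N by rewrite (cardsD1 m0 K) m0K addKn.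
have KD (f : N -> H) : \sum_(n in K) f n = f m0 + \sum_(n in K :\ m0) f n.
  rewrite (bigD1 m0) //=; congr (_ + _); apply: eq_bigl => n.
  by rewrite !inE andbC.
exists (fun i => psi (enum_val i)); split; last first.
  rewrite -family_span_enum; apply/seteqP; split=> y [c ->] /=.
    (* Subtracting this multiple of [null_comb] cancels the coefficient at [m0], since
       [sconj F (u m0) * u m0 = 1]. *)
    exists (fun n => c n - c m0 * u m0 * sconj F (u n)).
    transitivity (\sum_(n in K) (c n - c m0 * u m0 * sconj F (u n)) *: psi n).
      under [RHS]eq_bigr => n _ do rewrite scalerBl -[_ *: psi n in X in _ - X]scalerA.
      by rewrite sumrB -scaler_sumr null_comb scaler0 subr0.
    by rewrite KD -mulrA [u m0 * _]mulrC u_conj mulr1 subrr scale0r add0r.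
  exists (fun n => if n == m0 then 0 else c n); rewrite KD eqxx scale0r add0r.
  by apply: eq_bigr => n; rewrite !inE => /andP[/negbTE -> _].
move=> c c0.
have xK (i : 'I_#|K :\ m0|) : enum_val i \in K.
  by have := enum_valP i; rewrite !inE => /andP[].
(* Pair the vanishing combination with [psi k]. At [k = m0], outside the index set, the left side is
   0, so the sum on the right is 0; the other [k] then show that [q] times each coefficient is 0. *)
have ck k : k \in K -> \sum_i c i * (q%:R * (k == enum_val i)%:R) =
    sconj F (u k) * \sum_i c i * u (enum_val i).
  move=> kK; apply/eqP; rewrite -subr_eq0; apply/eqP.
  rewrite -[RHS](inner0r (psi k)) -c0 inner_sumr mulr_sumr -sumrB.
  by apply: eq_bigr => i _; rewrite gram //; ring.
have uc_neq0 n : sconj F (u n) != 0.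
  by apply/eqP => h; have /eqP := u_conj n; rewrite h mul0r eq_sym oner_eq0.
have s0 : \sum_i c i * u (enum_val i) = 0.
  have /eqP := ck m0 m0K; rewrite big1 => [|i _].
    by rewrite eq_sym mulf_eq0 (negbTE (uc_neq0 _)) => /eqP.
  by have := enum_valP i; rewrite !inE eq_sym => /andP[/negbTE -> _]; rewrite !mulr0.
move=> i; have := ck _ (xK i); rewrite s0 mulr0 (bigD1 i) //= eqxx mulr1.
rewrite big1 => [/eqP|j ji]; last first.
  by rewrite (inj_eq enum_val_inj) eq_sym (negbTE ji) !mulr0.
rewrite addr0 mulf_eq0 pnatr_eq0 => /orP[/eqP //|/eqP q0].
by move: q_gt1; rewrite q0.
Qed.

Lemma regular_simplexI : regular_simplex psi K.
Proof. by split; [exact: simplex_is_etf | exact: simplex_has_dim]. Qed.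

End Sufficient.

End Simplex.

(** * The characters *)

Section Character.
Variables (R : realType) (P : nat).
Hypothesis P_prime : prime P.
Implicit Types a b : 'F_P.
Local Notation chi := (@character R P).
Local Notation omega := (cexp (Complex 0 (2 * pi / P%:R : R))).

Lemma cexpD (z w : R[i]) : cexp (z + w) = cexp z * cexp w.
Proof.
case: z w => [x y] [x' y']; rewrite /cexp /= expRD cosD sinD.
apply/eqP; rewrite eq_complex /=; apply/andP; split; apply/eqP; ring.
Qed.

Lemma cexpX (t : R) n : cexp (Complex 0 t) ^+ n = cexp (Complex 0 (t * n%:R)).
Proof.
elim: n => [|n IH].
  by rewrite mulr0 /cexp /= expR0 cos0 sin0 !mul1r expr0.
rewrite exprS IH -cexpD; congr cexp; apply/eqP.
by rewrite eq_complex /= addr0 eqxx -[n.+1%:R]natr1 mulrDr mulr1 addrC eqxx.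
Qed.

Lemma character_exp b : chi b = omega ^+ (val b).
Proof. by rewrite cexpX. Qed.

(** For nontriviality: the angle [2 * pi / P] is positive and at most [pi] since [P] is at least 2,
    and cosine is injective on that range. *)
Lemma omega_prim : omega ^+ P = 1 /\ omega != 1.
Proof.
have P0 : (P%:R : R) != 0 by rewrite pnatr_eq0 -lt0n prime_gt0.
split.
  rewrite cexpX divfK // /cexp /= expR0 !mul1r mulr_natl.
  by rewrite cos2pi sin2pi.
apply/negP; rewrite eq_complex /= expR0 !mul1r => /andP[/eqP c1 _].
have P2 : (2 <= P%:R :> R) by rewrite ler_nat prime_gt1.
have t0 : 0 < 2 * pi / P%:R :> R.
  by rewrite divr_gt0 ?mulr_gt0 ?pi_gt0 ?ltr0n ?prime_gt0.
have tpi : 2 * pi / P%:R <= pi :> R.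
  by rewrite ler_pdivrMr ?ltr0n ?prime_gt0 // mulrC ler_wpM2l // pi_ge0.
have := @cos_inj R (2 * pi / P%:R) 0; rewrite !in_itv /= lexx pi_ge0 (ltW t0) tpi.
by rewrite c1 cos0 => /(_ isT isT erefl) e; move: t0; rewrite e ltxx.
Qed.

Lemma characterD a b : chi (a + b) = chi a * chi b.
Proof.
rewrite !character_exp -exprD -[in RHS](expr_mod _ omega_prim.1).
by congr (_ ^+ _); apply: (congr1 (modn _) (Fp_cast P_prime)).
Qed.

Lemma character0 : chi 0 = 1.
Proof. by rewrite character_exp expr0. Qed.

(** Bezout: a nonzero [val b] is coprime to [P], so [omega ^+ P = 1] and [omega ^+ val b = 1] would
    give [omega = 1]. *)
Lemma character_eq1 b : chi b = 1 -> b = 0.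
Proof.
have [w1 wn1] := omega_prim.
rewrite character_exp => wb; apply/eqP; apply: contraNT wn1 => b0.
have bP : (val b < P)%N by rewrite -[X in (_ < X)%N](Fp_cast P_prime) ltn_ord.
have vb0 : (0 < val b)%N by rewrite lt0n.
have /eqP cop : coprime P (val b).
  by rewrite prime_coprime // gtnNdvd.
have [u v uv _] := egcdnP (val b) (prime_gt0 P_prime).
have : omega ^+ (u * P) = omega ^+ (v * val b + gcdn P (val b)) by rewrite uv.
rewrite cop exprD expr1 mulnC exprM w1 expr1n mulnC exprM wb expr1n mul1r.
by move=> <-.
Qed.

Lemma character_conj b : (chi b)^* = chi (- b).
Proof.
have n1 : chi b * (chi b)^* = 1.
  rewrite /character /cexp /= expR0 !mul1r; apply/eqP; rewrite eq_complex /=.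
  apply/andP; split; apply/eqP; last by ring.
  by rewrite mulrN opprK -!expr2 cos2Dsin2.
by rewrite -[LHS]mul1r -character0 -(addNr b) characterD -mulrA n1 mulr1.
Qed.

(** Pulls the characters back from [R[i]] to the scalars of the frame. For [P = 2] the values are
    the signs [(-1) ^+ val b], fixed by conjugation, and [- b = b]. *)
Lemma scalar_character : exists c : 'F_P -> symplectic_scalars R P,
  (forall b, sembed _ (c b) = chi b) /\ (forall b, sconj _ (c b) = c (- b)).
Proof.
rewrite /symplectic_scalars; case: eqP => [P2|_]; last first.
  by exists chi; split=> // b; apply: character_conj.
have wR : omega = real_complex R (-1).
  by rewrite P2 mulrC mulKf ?pnatr_eq0 // /cexp /= expR0 cospi sinpi mulr0 mul1r.
have chiR b : real_complex R ((-1) ^+ val b) = chi b.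
  by rewrite rmorphXn /= -wR -character_exp.
exists (fun b => (-1) ^+ val b : R); split=> // b /=.
apply: (fmorph_inj (real_complex R)).
apply: (etrans (chiR b)); apply: (etrans _ (esym (chiR (- b)))).
have bb : b + b = 0.
  by rewrite -mulr2n -mulr_natl -[X in X%:R]P2 pchar_Fp_0 // mul0r.
by congr (@character R P _); apply/eqP; rewrite -addr_eq0 bb.
Qed.

End Character.

(** * The binder of the dual symplectic frame *)

Section DualBinder.
Variables (R : realType) (P J : nat) (V : vectType 'F_P) (B : {biscalar V}).
Variables (H : hilbert (symplectic_scalars R P)) (Psi : finvect_type V -> H).
Hypothesis P_prime : prime P.
Hypothesis J_gt0 : (0 < J)%N.
Hypothesis dimV : (\dim {:V} = 2 * J)%N.
Hypothesis sympB : symplectic_form B.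
Hypothesis hPsi : dual_symplectic_etf B J Psi.

Let T : finLmodType 'F_P := finvect_type V.
Let b : {biscalar T} := B.
Local Notation F := (symplectic_scalars R P).
Local Notation lagr := (lagrangians b [set: T]).

Lemma symplectic_alt (v : T) : b v v = 0.
Proof. exact: sympB.1. Qed.

Lemma symplectic_nd (v : T) : v != 0 -> exists w, b v w != 0.
Proof. exact: sympB.2. Qed.

Lemma card_symplectic_space : #|T| = (#|'F_P| ^ (2 * J))%N.
Proof.
rewrite -dimV.
have <- := @card_vspace _ (finvect_type V) _ {:(finvect_type V : vectType 'F_P)}%VS.
by apply: eq_card => x; rewrite (@memvf _ V).
Qed.

Lemma affine_lagrangianE (K : {set T}) :
  affine_lagrangian B K <-> K \in translates lagr.
Proof.
split=> [[v [L [LE ->]]]|/imset2P[v L _ LL ->]].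
  apply/imset2P; exists v L; rewrite ?finset.in_setT // inE finset.setTI.
  by apply/eqP.
by exists v, L; split=> //; move: LL; rewrite inE finset.setTI => /eqP.
Qed.

Lemma expPJ_gt1 : (1 < P ^ J)%N.
Proof. by rewrite -{1}(expn0 P) ltn_exp2l ?prime_gt1. Qed.

Lemma mem_dual_binder (K : {set T}) : K \in binder Psi <-> K \in translates lagr.
Proof.
have [c [cE cconj]] := scalar_character R P_prime.
have cinj x y : sembed F x = sembed F y -> x = y by apply: fmorph_inj.
have cD x y : c (x + y) = c x * c y.
  by apply: cinj; rewrite rmorphM /= !cE characterD.
have c0 : c 0 = 1 by apply: cinj; rewrite rmorph1 /= cE character0.
have cN x : c x * c (- x) = 1 by rewrite -cD subrr.
have c_inj x y : c x = c y -> x = y.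
  move=> cxy; apply/eqP; rewrite -subr_eq0; apply/eqP.
  apply: (@character_eq1 R _ P_prime).
  by rewrite -cE cD cxy cN rmorph1.
(* Deriving this from [c x ^+ P = 1] treats the real and the complex scalars alike. *)
have c_norm x : `|c x| = 1.
  have cX n : c (x *+ n) = c x ^+ n.
    by elim: n => [|n IH]; rewrite ?mulr0n ?c0 // mulrS exprS cD IH.
  have /(congr1 Num.norm) : c x ^+ P = 1.
    by rewrite -cX -mulr_natl pchar_Fp_0 // mul0r.
  rewrite normrX normr1 => /eqP.
  by rewrite pexprn_eq1 ?normr_ge0 // eqn0Ngt prime_gt0 //= => /eqP.
have psi_norm n : inner (Psi n) (Psi n) = (P ^ J)%:R - 1 := hPsi.1 n.
have psi_inner n1 n2 : n1 != n2 -> inner (Psi n1) (Psi n2) = - c (b n1 n2).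
  by move=> n12; apply: cinj; rewrite rmorphN /= cE; apply: hPsi.2.
have cardF : #|'F_P| = P by rewrite card_Fp.
have isoL S := @isotropic_lagrangian _ T b J symplectic_alt symplectic_nd
  card_symplectic_space S.
split=> [|/imset2P[v L _ LL ->]].
  rewrite inE => /asboolP rs.
  have [cK eK] := @regular_simplex_gram _ _ _ _ Psi K (P ^ J)
    (fun i j => c (b i j)) expPJ_gt1 psi_norm psi_inner
    (fun n => etrans (congr1 c (symplectic_alt n)) c0)
    (fun n1 n2 => etrans (congr1 (fun z => c (b n1 n2) * c z)
       (alt_skew symplectic_alt n2 n1)) (cN _)) rs.
  have [k kK] : exists k, k \in K.
    by apply/set0Pn; rewrite -card_gt0 cK ltnW ?expPJ_gt1.
  have KE : K = translate k (translate (- k) K).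
    by apply/setP => x; rewrite !mem_translate opprK subrK.
  apply/imset2P; exists k (translate (- k) K); rewrite ?finset.in_setT //.
  apply: isoL; last by rewrite card_translate cK cardF.
  (* With [x + k] and [y + k] in [K], the cocycle identity reads [b (x + k) (y + k) = b (x + k) k +
     b k (y + k)]; expanding leaves [b x y = 0]. *)
  move=> x y; rewrite !mem_translate !opprK => xK yK.
  have := c_inj _ _ (etrans (eK _ _ xK yK k kK) (esym (cD _ _))).
  rewrite !linearDl !linearDr /= symplectic_alt !addr0 => /eqP.
  rewrite [X in _ == X]addrC -subr_eq0 => /eqP h; rewrite -h; ring.
rewrite inE; apply/asboolP.
have cardL : #|L| = (P ^ J)%N.
  rewrite -[X in (X ^ J)%N]cardF.
  apply: (card_lagrangian symplectic_alt _ _ _ LL); first exact: setT_submod.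
    exact: setT_nondegenerate symplectic_nd.
  by rewrite cardsT card_symplectic_space.
(* Isotropy of [L] gives [b i j = b v j - b v i] on [v + L], so [c (b i j)] is a rank-one matrix
   with factor [u n = c (b v n)]. *)
apply: (@regular_simplexI _ _ _ _ Psi _ (P ^ J) (fun n => c (b v n))).
- exact: expPJ_gt1.
- by rewrite card_translate.
- by move=> n; apply: c_norm.
- by move=> n; rewrite cconj mulrC cN.
move=> i j; rewrite !mem_translate => iL jL.
have bij : b i j = b v j - b v i.
  have := lagrangian_isotropic LL iL jL; rewrite linearBl !linearBr /=.
  rewrite symplectic_alt subr0 (alt_skew symplectic_alt i v) => h.
  by rewrite -[LHS]subr0 -h; ring.
have [<-|ij] := eqVneq i j; first by rewrite psi_norm mulr1 cconj mulrC cN.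
by rewrite psi_inner // mulr0 sub0r bij cD cconj mulrC.
Qed.

(** Stated for any family of Lagrangians covering the nonzero vectors evenly, so as to apply both to
    all Lagrangians and to a spread. *)
Lemma binder_bibd (D : {set {set T}}) lam r :
  D \subset lagr -> #|D| = r -> (0 < r)%N ->
  (forall x, x != 0 -> #|[set L in D | x \in L]%SET| = lam) ->
  forms_bibd (translates D) (P ^ (2 * J)) (P ^ J) lam r (P ^ J * r).
Proof.
move=> /fintype.subsetP DL <- r0 Dlam.
have cardF : #|'F_P| = P by rewrite card_Fp.
have cT : #|T| = (P ^ (2 * J))%N by rewrite card_symplectic_space cardF.
rewrite -cT; apply: translates_bibd => //.
- by move=> L /DL /lagrangian_zmod.
- move=> L /DL LL; rewrite -[X in (X ^ J)%N]cardF.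
  apply: (card_lagrangian symplectic_alt _ _ _ LL); first exact: setT_submod.
    exact: setT_nondegenerate symplectic_nd.
  by rewrite cardsT card_symplectic_space.
- exact: expPJ_gt1.
- by rewrite muln_gt0 r0 expn_gt0 prime_gt0.
- by rewrite cT mul2n -addnn expnD mulnAC.
Qed.

End DualBinder.

Theorem theorem4p5 (R : realType) (P J : nat) (P_prime : prime P)
    (J_gt0 : (0 < J)%N)
    (V : vectType 'F_P) (dimV : (\dim {:V} = 2 * J)%N)
    (B : {biscalar V}) (sympB : symplectic_form B)
    (H1 H2 : hilbert (symplectic_scalars R P))
    (Phi : finvect_type V -> H1) (hPhi : symplectic_etf B J Phi)
    (Psi : finvect_type V -> H2) (hPsi : dual_symplectic_etf B J Psi) :
  [/\ forall K : {set finvect_type V},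
        K \in binder Psi <-> affine_lagrangian B K,
      forms_bibd (binder Psi)
        (P ^ (2 * J)) (P ^ J)
        (\prod_(1 <= j < J) (P ^ j + 1))
        (\prod_(1 <= j < J.+1) (P ^ j + 1))
        (P ^ J * \prod_(1 <= j < J.+1) (P ^ j + 1))
    & exists2 X : {set {set finvect_type V}},
        X \subset binder Psi & forms_affine_plane X (P ^ J)].
Proof.
pose T : finLmodType 'F_P := finvect_type V; pose b : {biscalar T} := B.
have memE := mem_dual_binder P_prime J_gt0 dimV sympB hPsi.
have binderE : binder Psi = translates (lagrangians b [set: T]).
  by apply/setP => K; apply/idP/idP => /memE.
have b_alt := symplectic_alt sympB; have b_nd := symplectic_nd sympB.
have cT := card_symplectic_space dimV.
have cardF : #|'F_P| = P by rewrite card_Fp.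
have Tsub := setT_submod T.
have Tnd := setT_nondegenerate b_nd.
split.
- by move=> K; apply: (iff_trans (memE K)); apply: iff_sym (affine_lagrangianE B K).
- rewrite binderE; apply: (binder_bibd P_prime J_gt0 dimV sympB) => //.
  + rewrite (card_lagrangians b_alt Tsub Tnd (j := J)) ?cardF //.
    by rewrite cardsT cT cardF.
  + by apply: prodn_gt0 => j; rewrite addn1.
  (* The Lagrangians through [x] are counted in dimension [2 * (J - 1)], so the product stops at
     [J - 1]; [J] is rewritten as a successor to match. *)
  + move=> x x0; rewrite -[J in RHS](prednK J_gt0) -[P in RHS]cardF.
    apply: (card_lagrangians_nonzero b_alt Tsub Tnd) => //.
      by rewrite cardsT cT prednK.
- have [E dE] := prime_field_extension P_prime J_gt0.
  have [D [DL cD D1]] := lagrangian_spread b_alt b_nd cT J_gt0 dE.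
  exists (translates D).
    rewrite binderE; apply/fintype.subsetP => K /imset2P[v L vT LD ->].
    by apply: imset2_f => //; apply: (fintype.subsetP DL).
  (* With [Q = P ^ J], the spread has [Q + 1] members and exactly one through each nonzero vector,
     whence [R = Q + 1] and [Lambda = 1]. *)
  rewrite /forms_affine_plane -expnM [(J * 2)%N]mulnC.
  apply: (binder_bibd P_prime J_gt0 dimV sympB) => //; first by rewrite cD cardF.
  by rewrite addn1.
Qed.
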